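(* For every tree poset $P$ of height $k$, every real $\varepsilon>0$ and every positive integer $\ell$ there exists $\delta=\delta(\varepsilon,P,\ell)>0$ such that the following holds. Let $n$ be sufficiently large and let $\mathcal{F}\subseteq\widetilde{\mathcal{B}}_n$ be an $\ell$-gapped family with $|\mathcal{F}|\geq(k-1+\varepsilon)\binom{n}{\lfloor n/2\rfloor}$. Then there is a collection $\mathcal{H}$ of induced copies of $P$ in $\mathcal{F}$ satisfying 1. $|\mathcal{H}|\geq\delta^{|P|}n^{\ell(|P|-1)}\binom{n}{\lfloor n/2\rfloor}$; 2. $\Delta_j(\mathcal{H})\le(\delta n^{\ell})^{|P|-j}$ for all $1\le j\le|P|$.
   Context: $\widetilde{\mathcal{B}}_n=\{F\subseteq[n]: |\,|F|-n/2\,|<2\sqrt{n\ln n}\}$. A tree poset is a finite poset whose Hasse diagram is a tree; height is the largest number of elements in a chain; $|P|$ is the number of elements. An induced copy of $P$ in $\mathcal{F}$ is a subfamily that is the image of an injective map $f:P\to\mathcal{F}$ with $f(x)\subsetneq f(y)$ iff $x<_P y$. $\mathcal{F}$ is $\ell$-gapped if $|G\setminus F|\ge\ell$ whenever $F,G\in\mathcal{F}$, $F\subsetneq G$. A collection $\mathcal{H}$ of induced copies is viewed as a $|P|$-uniform hypergraph on vertex set $\mathcal{F}$ whose edges are the member-sets of the copies; for $\mathcal{D}\subseteq\mathcal{F}$, $\deg_{\mathcal{H}}(\mathcal{D})$ is the number of edges containing $\mathcal{D}$, and $\Delta_j(\mathcal{H})=\max_{|\mathcal{D}|=j}\deg_{\mathcal{H}}(\mathcal{D})$.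 *)

(* Defs.v *)
From Stdlib Require Import Reals.
From mathcomp Require Import all_boot all_order.
Set Implicit Arguments. Unset Strict Implicit. Unset Printing Implicit Defensive.
Import Order.TTheory.

Section Posets.
Context {d : Order.disp_t} {P : finPOrderType d}.

Definition covers (x y : P) : bool :=
  (x < y)%O && [forall z : P, ~~ ((x < z)%O && (z < y)%O)].

Definition hasse_adj : rel P := fun x y => covers x y || covers y x.

Definition tree_poset : Prop :=
  [/\ 0 < #|P|,
      (forall x y : P, connect hasse_adj x y) &
      (forall s : seq P, 3 <= size s -> ~~ (cycle hasse_adj s && uniq s))].

Definition is_chain (C : {set P}) : bool :=
  [forall x in C, forall y in C, (x <= y)%O || (y <= x)%O].

Definition height : nat := \max_(C : {set P} | is_chain C) #|C|.

Definition induced_copy (n : nat) (F S : {set {set 'I_n}}) : Prop :=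
  exists f : P -> {set 'I_n},
    [/\ injective f, (forall x, f x \in F),
        (forall x y, (f x \proper f y) = (x < y)%O) &
        S = f @: [set: P]].
End Posets.

Definition middle_layers (n : nat) : {set {set 'I_n}} :=
  [set A : {set 'I_n} |
    if Rlt_dec (Rabs (Rminus (INR #|A|) (Rdiv (INR n) (INR 2))))
            (Rmult (INR 2) (sqrt (Rmult (INR n) (ln (INR n))))) then true else false ].

Definition gapped (n l : nat) (F : {set {set 'I_n}}) : Prop :=
  forall A B, A \in F -> B \in F -> A \proper B -> l <= #|B :\: A|.

Definition hdeg (n : nat) (H : {set {set {set 'I_n}}}) (D : {set {set 'I_n}}) : nat :=
  #|[set E in H | D \subset E]|.

Definition hDelta (n : nat) (F : {set {set 'I_n}}) (H : {set {set {set 'I_n}}}) (j : nat) : nat :=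
  \max_(D in powerset F | #|D| == j) hdeg H D.

(* Main.v *)
(* Chains are encoded by permutations. In a uniformly random maximal chain the expected number of
   members lying in F is at least k - 1 + eps, so there are many windows of k consecutive members.
   Choosing sets L_0, ..., L_(k-1) of members of F that maximise the number of windows whose i-th
   entry is in L_i, minus a small multiple of the total weight of the L_i, yields a robust
   structure: for A in L_i, a positive proportion of the chains through A meet every L_j.

   A tree poset is embedded vertex by vertex along its Hasse diagram, sending x into L_(rank x).
   From the image A of the neighbour already embedded, a random chain through A is unlikely to
   pass through one of o(n^l) forbidden sets (gappedness puts them at distance at least l) and,
   since only O(sqrt(n ln n)) levels matter, unlikely to create an unwanted comparability.

   The collection H is built greedily. A set X of j members is saturated when its degree cannot
   grow any more; double counting shows that few single members are saturated and that a given X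
   has only O(delta n^l) saturated one-point extensions. Hence as long as H is too small there is
   a copy of P none of whose nonempty subsets is saturated, and it can be added to H. *)

Require Import Defs.
From Stdlib Require Import Reals Lra.
From mathcomp Require Import all_boot all_order.
From mathcomp Require Import perm fingroup.
From mathcomp Require Import zify.
Set Implicit Arguments. Unset Strict Implicit. Unset Printing Implicit Defensive.

(** * Random maximal chains *)

Lemma exchange_card (I J : finType) (X : {pred I}) (Y : {pred J}) (R : I -> J -> bool) :
  \sum_(j in Y) #|[set i in X | R i j]| = \sum_(i in X) #|[set j in Y | R i j]|.
Proof.
under eq_bigr => j _ do rewrite -sum1_card.
under [RHS]eq_bigr => i _ do rewrite -sum1_card.
rewrite (exchange_big_dep (fun i => i \in X)) /=; last by move=> j i _; rewrite inE => /andP[].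
apply: eq_bigr => i iX; apply: eq_bigl => j.
by rewrite !inE iX.
Qed.

Lemma sum_card_le (I J : finType) (X : {pred I}) (Y : {pred J}) (R : I -> J -> bool) c :
    (forall i, i \in X -> #|[set j in Y | R i j]| <= c) ->
  \sum_(j in Y) #|[set i in X | R i j]| <= c * #|X|.
Proof.
move=> le_c; rewrite exchange_card mulnC -sum_nat_const; exact: leq_sum.
Qed.

(** * Estimates for binomial coefficients *)

Lemma leq_bin_mid n b : 'C(n, b) <= 'C(n, n./2).
Proof.
have up m : m < n./2 -> 'C(n, m) <= 'C(n, m.+1).
  move=> mn; rewrite -(leq_pmul2l (ltn0Sn m)) mul_bin_left leq_mul2r.
  by apply/orP; right; lia.
have mono d : forall m, m + d = n./2 -> 'C(n, m) <= 'C(n, n./2).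
  elim: d => [|d IH] m; first by rewrite addn0 => ->.
  move=> e; apply: (leq_trans (up m _)); first by lia.
  by apply: IH; lia.
case: (leqP b n./2) => hb; first by apply: (mono (n./2 - b)); lia.
case: (leqP b n) => hn; last by rewrite bin_small.
rewrite -bin_sub //; apply: (mono (n./2 - (n - b))); lia.
Qed.

(** Counting nested pairs gives $\binom mb\binom bl=\binom ml\binom{m-l}{b-l}$, and $\binom
    bl=\binom b{b-l}\le\binom{m-l}{b-l}$ because $b\le m-l$. *)
Lemma leq_bin_far m b l : l <= b -> b + l <= m -> 'C(m, l) <= 'C(m, b).
Proof.
move=> lb blm.
have E1 : 'C(m, b) * 'C(b, l) = 'C(m, l) * 'C(m - l, b - l).
  have bm : b <= m by lia.
  have lm : l <= m by lia.
  have blm' : b - l <= m - l by lia.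
  have:= bin_fact bm; have:= bin_fact lb; have:= bin_fact lm; have:= bin_fact blm'.
  have -> : m - l - (b - l) = m - b by lia.
  have := fact_gt0 l; have := fact_gt0 (b - l); have := fact_gt0 (m - b).
  move: 'C(m, b) 'C(b, l) 'C(m, l) 'C(m - l, b - l) => x y z w.
  move: l`! (b - l)`! (m - b)`! (m - l)`! b`! m`! => f1 f2 f3 f4 f5 f6 p1 p2 p3 e1 e2 e3 e4.
  have p : 0 < f1 * (f2 * f3) by rewrite !muln_gt0 p1 p2 p3.
  apply/eqP; rewrite -(eqn_pmul2r p); apply/eqP.
  transitivity f6; first by rewrite -e4 -e3; nia.
  by rewrite -e2 -e1; nia.
have E2 : 'C(b, l) <= 'C(m - l, b - l) by rewrite -bin_sub //; apply: leq_bin2l; lia.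
have b0 : 0 < 'C(b, l) by rewrite bin_gt0.
by rewrite -(leq_pmul2r b0) E1 leq_mul2l E2 orbT.
Qed.

(** For $i<l\le n/6$ each factor $m-i$ of the falling factorial is at least $n/3-n/6=n/6$. *)
Lemma exp_leq_bin n m l : n <= 3 * m -> 6 * l <= n -> n ^ l <= 6 ^ l * l`! * 'C(m, l).
Proof.
move=> nm ln; rewrite -mulnA [l`! * _]mulnC bin_ffact.
have ->: n ^ l = \prod_(i < l) n by rewrite prod_nat_const card_ord.
have ->: 6 ^ l * m ^_ l = \prod_(i < l) (6 * (m - i)).
  by rewrite big_split /= prod_nat_const card_ord ffact_prod.
by apply: leq_prod => i _; have := ltn_ord i; lia.
Qed.

(** * Chains through one or two prescribed sets *)

Section Chains.
Variable n : nat.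
Implicit Types (A B C : {set 'I_n}) (s : {perm 'I_n}).

(* A permutation [s] encodes the maximal chain whose [m]-th member is [lev s m]. *)
Definition lev s m : {set 'I_n} := [set x | s x < m].

Definition through A : {set {perm 'I_n}} :=
  [set s : {perm 'I_n} | [forall x, (x \in A) == (s x < #|A|)]].

Lemma throughP s A : reflect (forall x, (x \in A) = (s x < #|A|)) (s \in through A).
Proof. by rewrite inE; apply: (iffP forallP) => h x; apply/eqP. Qed.

Lemma card_lev s m : m <= n -> #|lev s m| = m.
Proof.
move=> mn; rewrite -(card_imset _ (@perm_inj _ s)).
have -> : s @: lev s m = [set y : 'I_n | y < m].
  apply/setP=> y; rewrite inE; apply/imsetP/idP => [[x]|ym]; first by rewrite inE => ? ->.
  by exists (s^-1%g y); rewrite ?inE permKV.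
by rewrite cardsE -sum1_card (big_ord_narrow mn) sum1_card card_ord.
Qed.

Lemma through_lev s m : m <= n -> s \in through (lev s m).
Proof. by move=> mn; apply/throughP => x; rewrite card_lev // inE. Qed.

Lemma lev_through s A : s \in through A -> lev s #|A| = A.
Proof. by move/throughP => h; apply/setP=> x; rewrite inE h. Qed.

Lemma card_le_n A : #|A| <= n.
Proof. by have := max_card (mem A); rewrite card_ord. Qed.

Lemma through_tperm x y s A :
  ((tperm x y * s)%g \in through A) = (s \in through (tperm x y @: A)).
Proof.
set t := tperm x y.
have mt z : (z \in t @: A) = (t z \in A).
  by rewrite -{1}[z](tpermK x y) mem_imset //; apply: perm_inj.
have ct : #|t @: A| = #|A| by rewrite card_imset //; apply: perm_inj.
apply/throughP/throughP => h z; first by rewrite mt ct h permM tpermK.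
by rewrite permM -ct -h mt tpermK.
Qed.

Lemma tperm_imset_id x y A : (x \in A) = (y \in A) -> tperm x y @: A = A.
Proof.
move=> e; apply/eqP; rewrite eqEcard (card_imset _ (@perm_inj _ _)) leqnn andbT.
by apply/subsetP => z /imsetP[w wA ->]; case: tpermP => [wx|wy|//]; rewrite -?e -?wx // e -wy.
Qed.

(** Exchanging $x\in B\setminus B'$ with $y\in B'\setminus B$ fixes [A] as a set, so composing with
    the transposition is a bijection of chains that preserves [through A] and brings [B] closer to
    [B']. *)
Lemma card_through2_eq A B B' : #|B| = #|B'| ->
    (forall x y, x \in B :\: B' -> y \in B' :\: B -> (x \in A) = (y \in A)) ->
  #|through A :&: through B| = #|through A :&: through B'|.
Proof.
move e: #|B :\: B'| => d; elim: d B e => [|d IH] B e cB sw.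
  have sBB' : B \subset B' by rewrite -setD_eq0 -cards_eq0 e.
  by have /eqP -> : B == B' by rewrite eqEcard sBB' cB leqnn.
have [x xB] : exists x, x \in B :\: B' by apply/set0Pn; rewrite -cards_eq0 e.
have [y yB'] : exists y, y \in B' :\: B.
  apply/set0Pn; rewrite -cards_eq0.
  have := cardsID B' B; have := cardsID B B'; rewrite setIC; lia.
have xyA := sw x y xB yB'.
move: (xB) (yB'); rewrite !inE => /andP[xNB' xinB] /andP[yNB yinB'].
have yx : (y == x) = false by apply: contraNF yNB => /eqP ->.
set t := tperm x y.
have mt z : (z \in t @: B) = (t z \in B).
  by rewrite -{1}[z](tpermK x y) mem_imset //; apply: perm_inj.
have tB : t @: B = y |: (B :\ x).
  apply/setP => z; rewrite mt !inE /t.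
  case: tpermP => [->|->|/eqP zx /eqP zy]; rewrite ?eqxx ?(negbTE yNB) ?xinB ?orbT //=.
    by rewrite eq_sym yx.
  by rewrite zx (negbTE zy).
have -> : #|through A :&: through B| = #|through A :&: through (t @: B)|.
  rewrite -(card_imset _ (@mulgI _ t)); apply: eq_card => s.
  rewrite -{1}(mulKVg t s) mem_imset; last exact: mulgI.
  by rewrite tpermV !in_setI !through_tperm tperm_imset_id.
apply: IH.
- have -> : t @: B :\: B' = (B :\: B') :\ x.
    apply/setP => z; rewrite tB !inE; case: (eqVneq z y) => [->|] /=; first by rewrite yinB' yx.
    by move=> _; case: (z == x); case: (z \in B'); rewrite ?andbF.
  by have := cardsD1 x (B :\: B'); rewrite xB e; lia.
- by rewrite card_imset //; apply: perm_inj.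
- move=> z w; rewrite tB !inE => /andP[zB' h] /andP[h2 wB'].
  have {}h : z \in B.
    by case/orP: h => [/eqP zy|/andP[]//]; rewrite zy yinB' in zB'.
  apply: sw; rewrite !inE ?zB' ?h //= wB' andbT.
  apply: contra h2 => wB; rewrite wB andbT; apply/orP; right.
  by apply: contraTN wB' => /eqP ->.
Qed.

(** A chain has only one member of each size, so the sets [through (G i)] are disjoint; inside
    [through A] each has as many chains as [through B]. *)
Lemma card_through2_family A B (I : finType) (X : {set I}) (G : I -> {set 'I_n}) :
    {in X &, injective G} -> (forall i, i \in X -> #|G i| = #|B|) ->
    (forall i x y, i \in X -> x \in B :\: G i -> y \in G i :\: B -> (x \in A) = (y \in A)) ->
  #|through A :&: through B| * #|X| <= #|through A|.
Proof.
move=> injG cG sw; rewrite mulnC -sum_nat_const.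
rewrite (eq_bigr (fun i => #|[set s in through A | s \in through (G i)]|)); last first.
  move=> i iX; rewrite (@card_through2_eq A B (G i)) ?cG //; last by move=> x y; apply: sw.
rewrite -[X in _ <= X]mul1n; apply: sum_card_le => s sA.
apply/card_le1_eqP => i j; rewrite !inE => /andP[iX si] /andP[jX sj].
apply: injG => //; rewrite -(@lev_through s (G i)) ?inE // -(@lev_through s (G j)) ?inE //.
by rewrite !cG.
Qed.

(** The competitors of [B] are the sets $A\cup D$ with $D$ disjoint from [A] and $|D|=|B|-|A|$. *)
Lemma card_through2_up A B : A \subset B ->
  #|through A :&: through B| * 'C(n - #|A|, #|B| - #|A|) <= #|through A|.
Proof.
move=> AB.
have cA : #|~: A| = n - #|A| by rewrite cardsCs card_ord setCK.
rewrite -cA -cards_draws; apply: (@card_through2_family _ _ _ _ (fun D => A :|: D)).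
- move=> D D'; rewrite !inE => /andP[DA _] /andP[DA' _] e.
  have k C : C \subset ~: A -> (A :|: C) :\: A = C.
    by move=> CA; rewrite setDUl setDv set0U; apply/setDidPl; rewrite disjoints_subset.
  by rewrite -(k D) // -(k D') // e.
- move=> D; rewrite inE => /andP[DA /eqP cD]; rewrite cardsU cD.
  have -> : A :&: D = set0 by apply/disjoint_setI0; rewrite disjoint_sym disjoints_subset.
  by rewrite cards0 subn0 subnKC // subset_leq_card.
- move=> D x y _; rewrite !inE negb_or => /andP[/andP[/negbTE -> _] _] /andP[yB _].
  by apply/esym; apply: contraNF yB; apply: (subsetP AB).
Qed.

Lemma card_through2_down A B : B \subset A ->
  #|through A :&: through B| * 'C(#|A|, #|A| - #|B|) <= #|through A|.
Proof.
move=> BA.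
rewrite -cards_draws; apply: (@card_through2_family _ _ _ _ (fun D => A :\: D)).
- move=> D D'; rewrite !inE => /andP[DA _] /andP[DA' _] e.
  have k C : C \subset A -> A :\: (A :\: C) = C by rewrite setDDr setDv set0U => /setIidPr.
  by rewrite -(k D) // -(k D') // e.
- move=> D; rewrite inE => /andP[DA /eqP cD]; rewrite cardsD (setIidPr DA) cD.
  by have := subset_leq_card BA; lia.
- move=> D x y _; rewrite !inE => /andP[_ /(subsetP BA) ->] /andP[_ /andP[_ ->]] //.
Qed.

(** By symmetry all sets of the size of [B] lie on equally many chains, and each of the $n!$ chains
    contains one of them. *)
Lemma card_through_ge B : n`! <= #|through B| * 'C(n, n./2).
Proof.
apply: (@leq_trans (#|through B| * 'C(n, #|B|))); last by rewrite leq_mul2l leq_bin_mid orbT.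
have -> : 'C(n, #|B|) = #|[set A : {set 'I_n} | #|A| == #|B|]| by rewrite card_draws card_ord.
rewrite -card_Sn.
rewrite mulnC -sum_nat_const.
rewrite (eq_bigr (fun D => #|[set s in setT | s \in through D]|)); last first.
  move=> D; rewrite inE => /eqP cD.
  have := @card_through2_eq set0 B D; rewrite cD => /(_ erefl).
  have e C : through set0 :&: through C = through C.
    apply/setIidPr/subsetP => s _; apply/throughP => x; rewrite cards0 !inE //.
  rewrite !e => -> //; last by move=> *; rewrite !inE.
  by apply: eq_card => s; rewrite !inE.
rewrite exchange_card -cardsT -sum1_card.
apply: leq_sum => s _; rewrite card_gt0; apply/set0Pn; exists (lev s #|B|).
by rewrite in_set in_set card_lev ?card_le_n // eqxx through_lev ?card_le_n.
Qed.

(* Positions start at [0]: [s x] is the step at which the chain of [s] acquires [x]. *)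
Definition through_at A (z : 'I_n * nat) : {set {perm 'I_n}} :=
  [set s in through A | s z.1 == z.2 :> nat].

(** Transposing [x] with elements on its own side of [A] shows that they all occupy a given position
    equally often; these events are disjoint, and each side has at least $n/3$ elements. *)
Lemma card_through_at A z : n <= 3 * #|A| -> n <= 3 * (n - #|A|) ->
  n * #|through_at A z| <= 3 * #|through A|.
Proof.
case: z => x m nA nA'.
suff h (X : {set 'I_n}) : x \in X -> (forall y, y \in X -> (x \in A) = (y \in A)) ->
    #|X| * #|through_at A (x, m)| <= #|through A|.
  case xA: (x \in A).
    have := h A xA; rewrite xA => /(_ (fun y yA => esym yA)); nia.
  have := h (~: A); rewrite !inE xA cardsCs card_ord setCK => /(_ isT) hh.
  have /hh : forall y, y \in ~: A -> false = (y \in A) by move=> y; rewrite inE => /negbTE ->.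
  nia.
move=> xX sw; rewrite -sum_nat_const.
rewrite (eq_bigr (fun y => #|[set s in through A | s y == m :> nat]|)); last first.
  move=> y yX; rewrite -(card_imset _ (@mulgI _ (tperm x y))); apply: eq_card => s.
  rewrite -{1}(mulKVg (tperm x y) s) mem_imset; last exact: mulgI.
  rewrite tpermV /through_at.
  rewrite [LHS]in_set [RHS]in_set through_tperm tperm_imset_id ?(sw x) ?(sw y) //=.
  by rewrite permM tpermL.
rewrite -[X in _ <= X]mul1n; apply: sum_card_le => s sA.
apply/card_le1_eqP => y w; rewrite !inE => /andP[_ /eqP ey] /andP[_ /eqP ew].
by apply: (@perm_inj _ s); apply: val_inj; rewrite /= ey ew.
Qed.

Lemma card_through_gt0 A : 0 < #|through A|.
Proof. by have := card_through_ge A; have := fact_gt0 n; nia. Qed.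

End Chains.

(** * Windows of consecutive members *)

Section Windows.
Variables (n k : nat) (F : {set {set 'I_n}}).
Implicit Types (A B : {set 'I_n}) (s : {perm 'I_n}) (L : {set 'I_k * {set 'I_n}}).

Definition members s : seq {set 'I_n} := [seq A <- mkseq (lev s) n.+1 | A \in F].

Lemma mem_members s A : (A \in members s) = (A \in F) && (s \in through A).
Proof.
rewrite mem_filter; case: (A \in F) => //=; apply/mapP/idP => [[m]|sA].
  by rewrite mem_iota => mn ->; apply: through_lev; lia.
by exists #|A|; rewrite ?lev_through // mem_iota; have := card_le_n A; lia.
Qed.

Lemma members_sorted s : sorted (fun A B => A \proper B) (members s).
Proof.
have tr : transitive (fun A B => A \proper B) by move=> B A C; apply: proper_trans.
apply: sorted_filter => //; rewrite /mkseq.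
apply/(sortedP set0) => i; rewrite size_map size_iota => ilt.
rewrite !(nth_map 0) ?size_iota //; try lia.
rewrite !nth_iota ?add0n; try lia.
rewrite properEcard !card_lev; try lia.
by rewrite ltnSn andbT; apply/subsetP => x; rewrite !inE; lia.
Qed.

Lemma members_uniq s : uniq (members s).
Proof.
apply: sorted_uniq (members_sorted s) => [B A C|A]; [exact: proper_trans | exact: properxx].
Qed.

Lemma sum_size_members : \sum_s size (members s) = \sum_(A in F) #|through A|.
Proof.
rewrite [RHS](eq_bigr (fun A => #|[set s in {perm 'I_n} | s \in through A]|)); last first.
  by move=> A _; apply: eq_card => s; rewrite [RHS]in_set.
rewrite exchange_card; apply: eq_bigr => s _.
rewrite -(card_uniqP (members_uniq s)); apply: eq_card => A.
by rewrite mem_members [RHS]in_set.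
Qed.

(** [L] encodes the sets $L_0,\dots,L_{k-1}$: the pair [(i, A)] belongs to [L] when $A\in L_i$. *)
Definition window L s j :=
  (j + k <= size (members s)) && [forall i : 'I_k, (i, nth set0 (members s) (j + i)) \in L].

Definition nwindows L := \sum_s count (window L s) (iota 0 n.+2).

Definition window_through L (z : 'I_k * {set 'I_n}) : {set {perm 'I_n}} :=
  [set s | has (fun j => window L s j && (nth set0 (members s) (j + z.1) == z.2)) (iota 0 n.+2)].

(* On a given chain at most one window has [z.2] as its [z.1]-th member. *)
Lemma nwindows_setD1 L z : nwindows L <= nwindows (L :\ z) + #|window_through L z|.
Proof.
rewrite -sum1_card big_mkcond -big_split /=; apply: leq_sum => s _.
rewrite inE; set a := fun j => window L s j && _.
have sub j : window L s j -> window (L :\ z) s j || a j.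
  move=> Lj; rewrite /a Lj /=; case/andP: (Lj) => jk /forallP jL.
  case: eqP => [|ne]; first by rewrite orbT.
  rewrite orbF /window jk /=; apply/forallP => i; rewrite in_setD1 jL andbT.
  by apply/negP => /eqP e; apply: ne; rewrite -e.
have cu : count (window L s) (iota 0 n.+2) <=
          count (window (L :\ z) s) (iota 0 n.+2) + count a (iota 0 n.+2).
  rewrite -(count_predUI _ a); apply: (leq_trans _ (leq_addr _ _)).
  by apply: sub_count => j; apply: sub.
apply: (leq_trans cu); rewrite leq_add2l.
case: ifP => [_|/negbT]; last by rewrite has_count -leqNgt.
apply: (@leq_trans (count (pred1 (index z.2 (members s) - z.1)) (iota 0 n.+2))).
  apply: sub_count => j /andP[/andP[jk _] /eqP e] /=.
  rewrite -e index_uniq ?members_uniq ?addnK //.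
  by apply: leq_trans jk; rewrite ltn_add2l ltn_ord.
by rewrite count_uniq_mem ?iota_uniq // leq_b1.
Qed.

Definition fullL : {set 'I_k * {set 'I_n}} := [set z | z.2 \in F].

(** On each chain all but the last $k-1$ members of [F] start a window. *)
Lemma nwindows_full : 0 < k ->
  \sum_s size (members s) <= nwindows fullL + k.-1 * n`!.
Proof.
move=> k0; rewrite -card_Sn mulnC -sum_nat_const.
rewrite [\sum_(i in _) _](_ : _ = \sum_(s : {perm 'I_n}) k.-1); last by apply: eq_bigl => s; rewrite inE.
rewrite -big_split; apply: leq_sum => s _; rewrite -[X in _ <= X]/(_ + k.-1).
have sz : size (members s) <= n.+1.
  by rewrite size_filter; apply: (leq_trans (count_size _ _)); rewrite size_mkseq.
set m := size (members s) in sz *.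
have [le|lt] := leqP m k.-1; first by apply: (leq_trans le); apply: leq_addl.
have -> : n.+2 = (m - k.-1) + (n.+2 - (m - k.-1)) by lia.
rewrite iotaD count_cat.
have -> : count (window fullL s) (iota 0 (m - k.-1)) = m - k.-1; last by lia.
rewrite -[RHS](size_iota 0); apply/eqP; rewrite -all_count; apply/allP => j.
rewrite mem_iota => jlt; rewrite /window; rewrite -/m; apply/andP; split; first by lia.
apply/forallP => i; rewrite inE /=.
have : nth set0 (members s) (j + i) \in members s.
  by apply: mem_nth; rewrite -/m; have := ltn_ord i; lia.
by rewrite mem_members => /andP[].
Qed.

Definition sumT := \sum_(A in F) #|through A|.

(** The hypothesis is $|F|\ge(k-1+1/e)\binom n{\lfloor n/2\rfloor}$ without denominators, and every
    set lies on at least $n!/\binom n{\lfloor n/2\rfloor}$ chains. *)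
Lemma sumT_ge e : (e * k.-1 + 1) * 'C(n, n./2) <= e * #|F| -> (e * k.-1 + 1) * n`! <= e * sumT.
Proof.
move=> h.
have C0 : 0 < 'C(n, n./2) by rewrite bin_gt0; lia.
have h2 : #|F| * n`! <= sumT * 'C(n, n./2).
  rewrite big_distrl /= -sum_nat_const; apply: leq_sum => A _; exact: card_through_ge.
rewrite -(leq_pmul2r C0).
have := leq_mul h (leqnn n`!); nia.
Qed.

(* Maximising the number of windows, with a penalty proportional to the number of
   chains through each retained pair, leaves only pairs through which a positive
   proportion of the chains have a window. *)
Lemma prune e : 0 < k -> (e * k.-1 + 1) * 'C(n, n./2) <= e * #|F| ->
  exists L : 'I_k -> {set {set 'I_n}},
  [/\ forall i, L i \subset F, forall i, L i != set0 &
      forall i A, A \in L i -> exists R : {set {perm 'I_n}},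
        #|through A| <= 2 * k * (e * k.-1 + 1) * #|R| /\
        forall s, s \in R -> s \in through A /\ forall j : 'I_k, exists B,
          [/\ B \in L j, s \in through B, i < j -> A \proper B & j < i -> B \proper A]].
Proof.
move=> k0 he; set q := 2 * k * _.
pose cnt (z : 'I_k * {set 'I_n}) := #|through z.2|.
(* To stay in [nat], [Psi] rewards the weight of discarded pairs instead of penalising that of
   retained ones. *)
pose Psi L := q * nwindows L + \sum_(z in fullL :\: L) cnt z.
case: (@arg_maxnP _ fullL (fun L => L \subset fullL) Psi (subxx _)) => L Lfull Lmax.
exists (fun i => [set A | (i, A) \in L]).
have LF i A : (i, A) \in L -> A \in F by move/(subsetP Lfull); rewrite inE.
(* If no window remained, [Psi L] would be at most $k$ times [sumT], whereas [q] is chosen so that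
   the full [L] already scores at least $2k$ times [sumT]. *)
have V0 : 0 < nwindows L.
  have nf0 := fact_gt0 n.
  have hT := sumT_ge he; have hV := nwindows_full k0; rewrite sum_size_members in hV.
  have PL := Lmax _ (subxx fullL); rewrite /= /Psi setDv big_set0 addn0 in PL.
  have cL : \sum_(z in fullL :\: L) cnt z <= k * sumT.
    apply: (@leq_trans (\sum_(z in fullL) cnt z)).
      rewrite [X in _ <= X](big_setID L) /= leq_addl //.
    rewrite (eq_bigl (fun z => (z.1 \in 'I_k) && (z.2 \in F))); last by move=> z; rewrite inE.
    rewrite -(pair_big (fun i => i \in 'I_k) (fun A => A \in F) (fun _ A => #|through A|)) /=.
    by rewrite sum_nat_const card_ord.
  rewrite lt0n; apply/eqP => V0; rewrite V0 muln0 add0n in PL.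
  have T0 : 0 < sumT by nia.
  have h1 : sumT <= (e * k.-1 + 1) * nwindows fullL.
    rewrite -/sumT in hV.
    have := leq_mul (leqnn (e * k.-1 + 1)) hV; rewrite mulnDr; nia.
  have h2 : 2 * k * sumT <= q * nwindows fullL by rewrite /q -(mulnA (2 * k)) leq_mul2l h1 orbT.
  have : 2 * k * sumT <= k * sumT by apply: leq_trans h2 (leq_trans PL cL).
  nia.
split.
- by move=> i; apply/subsetP => A; rewrite inE; apply: LF.
- move=> i; move: V0; rewrite lt0n sum_nat_eq0 negb_forall => /existsP[s].
  rewrite implyTb -lt0n -has_count => /hasP[j _ /andP[_ /forallP/(_ i) jL]].
  by apply/set0Pn; exists (nth set0 (members s) (j + i)); rewrite inE.
- move=> i A; rewrite inE => iA; exists (window_through L (i, A)); split.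
    (* Dropping [(i, A)] gains [cnt (i, A)] and loses at most [q] times the number of chains in
       [window_through]; maximality compares the two. *)
    have /Lmax : L :\ (i, A) \subset fullL by apply: subset_trans Lfull; apply: subsetDl.
    have eD : fullL :\: (L :\ (i, A)) = (i, A) |: (fullL :\: L).
      rewrite setDDr setUC; congr (_ :|: _); apply/setIidPr; rewrite sub1set inE; exact: LF iA.
    rewrite /Psi eD big_setU1 /=; last by rewrite !inE iA.
    have := nwindows_setD1 L (i, A); rewrite -/(cnt (i, A)).
    move: (nwindows _) (nwindows _) #|_| (cnt _) (\sum_(_ in _) _) => v1 v2 r c S; nia.
  move=> s; rewrite inE => /hasP[j _ /andP[/andP[jk /forallP jL] /eqP /= jA]].
  have im m : m < k -> j + m < size (members s) by lia.
  have th m : m < k -> s \in through (nth set0 (members s) (j + m)).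
    by move=> /im mk; have := mem_nth set0 mk; rewrite mem_members => /andP[].
  split; first by rewrite -jA; apply: th.
  have tr : transitive (fun A B => A \proper B) by move=> B' A' C'; apply: proper_trans.
  have lt := sorted_ltn_nth tr set0 (members_sorted s).
  move=> i'; exists (nth set0 (members s) (j + i')).
  split; [by rewrite inE jL | exact: th | |];
    by rewrite -jA => ii; apply: lt; rewrite ?inE ?im // ltn_add2l.
Qed.
End Windows.

(** * Extending along a random chain *)

Lemma card_bigcup_seq (T : finType) (I : Type) (r : seq I) (G : I -> {set T}) :
  #|\bigcup_(i <- r) G i| <= \sum_(i <- r) #|G i|.
Proof.
elim: r => [|i r IH]; first by rewrite !big_nil cards0.
rewrite !big_cons cardsU; by apply: (leq_trans (leq_subr _ _)); rewrite leq_add2l.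
Qed.

Lemma mem_bigcup_seq (T : finType) (I : Type) (r : seq I) (G : I -> {set T}) x :
  (x \in \bigcup_(i <- r) G i) = has (fun i => x \in G i) r.
Proof. by elim: r => [|i r IH]; rewrite ?big_nil ?big_cons !inE ?IH. Qed.

Lemma size_flatten_le (I T : Type) (r : seq I) (G : I -> seq T) c :
  (forall i, size (G i) <= c) -> size (flatten [seq G i | i <- r]) <= size r * c.
Proof.
move=> hG; elim: r => //= i r IH; by rewrite size_cat mulSn leq_add.
Qed.

Section Step.
Variables (n q l D : nat) (A : {set 'I_n}) (R : {set {perm 'I_n}}) (Forb : {set {set 'I_n}}).
Hypotheses (RA : R \subset through A) (AR : #|through A| <= q * #|R|).
Hypotheses (nA : n <= 3 * #|A|) (nA' : n <= 3 * (n - #|A|)) (ln : 6 * l <= n) (Dn : 3 * (D + l) <= n).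
Hypothesis n0 : 0 < n.
Hypothesis gapF : forall B, B \in Forb ->
  (A \proper B -> l <= #|B| - #|A| <= D) /\ (B \proper A -> l <= #|A| - #|B| <= D).
Hypothesis cardF : 3 * q * (6 ^ l * l`!) * #|Forb| <= n ^ l.

(** The sizes of [A] and [B] differ by some $b$ with $l\le b\le D$, so [B] competes with $\binom
    mb\ge\binom ml$ sets, where $m\ge n/3$ is the room above or below [A]. *)
Lemma card_through2_far B : B \in Forb -> (A \proper B) || (B \proper A) ->
  n ^ l * #|through A :&: through B| <= 6 ^ l * l`! * #|through A|.
Proof.
move=> BF cmp.
have key m b : n <= 3 * m -> l <= b <= D -> #|through A :&: through B| * 'C(m, b) <= #|through A| ->
    n ^ l * #|through A :&: through B| <= 6 ^ l * l`! * #|through A|.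
  move=> nm /andP[lb bD] h.
  have h1 := exp_leq_bin nm ln.
  have h2 : 'C(m, l) <= 'C(m, b) by apply: leq_bin_far => //; lia.
  have h3 := leq_trans h1 (leq_mul (leqnn _) h2).
  apply: (leq_trans (leq_mul h3 (leqnn _))); rewrite -mulnA leq_mul2l [X in X <= _]mulnC h orbT //.
have [gu gd] := gapF BF.
case/orP: cmp => AB.
  exact: key nA' (gu AB) (card_through2_up (proper_sub AB)).
exact: key nA (gd AB) (card_through2_down (proper_sub AB)).
Qed.

(** A union bound: the chains meeting a comparable forbidden set and the chains violating [Z] each
    form at most $1/(3q)$ of [through A], while [R] has at least $1/q$ of it. *)
Lemma avoid (Z : seq ('I_n * nat)) : 9 * q * size Z <= n ->
  exists2 s, s \in R &
    (forall B, B \in Forb -> (A \proper B) || (B \proper A) -> s \notin through B) /\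
    (forall z, z \in Z -> s z.1 != z.2 :> nat).
Proof.
move=> hZ.
pose r := [seq B : {set 'I_n} <- enum Forb | (A \proper B) || (B \proper A)].
pose U := \bigcup_(B <- r) (through A :&: through B).
pose V := \bigcup_(z <- Z) through_at A z.
have [/subsetP RUV|/subsetPn[s sR]] := boolP (R \subset U :|: V); last first.
  rewrite inE negb_or => /andP[sU sV]; exists s => //; split=> [B BF cmp|z zZ].
    apply: contra sU => sB; rewrite /U mem_bigcup_seq; apply/hasP; exists B.
      by rewrite mem_filter cmp mem_enum.
    by rewrite in_setI sB (subsetP RA).
  apply: contra sV => sz; rewrite /V mem_bigcup_seq; apply/hasP; exists z => //.
  by rewrite in_set sz (subsetP RA).
have A0 := card_through_gt0 A.
have cR : #|R| <= #|U| + #|V|.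
  apply: (leq_trans (subset_leq_card (introT subsetP RUV))).
  by rewrite cardsU leq_subr.
have nl0 : 0 < n ^ l by rewrite expn_gt0 n0.
have cU : 3 * q * #|U| <= #|through A|.
  rewrite -(leq_pmul2l nl0).
  have h1 : n ^ l * #|U| <= #|Forb| * (6 ^ l * l`! * #|through A|).
    apply: (@leq_trans (\sum_(B <- r) 6 ^ l * l`! * #|through A|)).
      apply: (leq_trans (leq_mul (leqnn _) (card_bigcup_seq _ _))).
      rewrite big_distrr /= big_seq [X in _ <= X]big_seq; apply: leq_sum => B.
      by rewrite mem_filter mem_enum => /andP[cmp BF]; apply: card_through2_far.
    rewrite big_const_seq count_predT iter_addn_0 mulnC leq_mul2r.
    by apply/orP; right; rewrite size_filter cardE count_size.
  have := leq_mul cardF (leqnn #|through A|).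
  move: (6 ^ l * l`!) h1 => K h1 h2.
  apply: leq_trans h2.
  have := leq_mul (leqnn (3 * q)) h1; move: (n ^ l) => N; rewrite !mulnA; lia.
have cV : 3 * q * #|V| <= #|through A|.
  rewrite -(leq_pmul2l n0).
  have h1 : n * #|V| <= size Z * (3 * #|through A|).
    apply: (leq_trans (leq_mul (leqnn _) (card_bigcup_seq _ _))).
    rewrite big_distrr /=; apply: (@leq_trans (\sum_(z <- Z) 3 * #|through A|)).
      by apply: leq_sum => z _; apply: card_through_at.
    by rewrite big_const_seq count_predT iter_addn_0 mulnC.
  have := leq_mul hZ (leqnn #|through A|); nia.
have : 3 * (q * #|R|) <= 3 * q * #|U| + 3 * q * #|V|.
  by rewrite -mulnDr mulnA leq_mul2l cR orbT.
lia.
Qed.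

Variables (W : {set {set 'I_n}}) (p : nat).
Hypotheses (Wp : #|W| <= p) (WD : 18 * q * p * D <= n).

Lemma avoid_family (Zf : {set 'I_n} -> seq ('I_n * nat)) :
    (forall C, size (if C \in W then Zf C else [::]) <= 2 * D) ->
  exists2 s, s \in R &
    (forall B, B \in Forb -> (A \proper B) || (B \proper A) -> s \notin through B) /\
    (forall C z, C \in W -> z \in Zf C -> s z.1 != z.2 :> nat).
Proof.
move=> hZf.
pose Z := flatten [seq (if C \in W then Zf C else [::]) | C <- enum W].
have [|s sR [h1 h2]] := @avoid Z.
  apply: (leq_trans _ WD).
  have -> : 18 * q * p * D = 9 * q * (p * (2 * D)) by lia.
  rewrite leq_mul2l; apply/orP; right.
  by apply: leq_trans (size_flatten_le _ hZf) _; rewrite -cardE leq_mul.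
exists s => //; split=> // C z CW zC; apply: h2; apply/flatten_mapP; exists C; first by rewrite mem_enum.
by rewrite CW.
Qed.

(** One element of [X] kept out of [D] consecutive positions is enough to refute an inclusion at
    every level in that range, at a cost of only [D] incidences. *)
Definition witness_run (X : {set 'I_n}) m : seq ('I_n * nat) :=
  if [pick x in X] is Some x then [seq (x, m + t) | t <- iota 0 D] else [::].

Lemma size_witness_run X m : size (witness_run X m) <= D.
Proof. by rewrite /witness_run; case: pickP => //= x _; rewrite size_map size_iota. Qed.

Lemma witness_runP (X : {set 'I_n}) m (s : {perm 'I_n}) :
    X != set0 -> (forall z, z \in witness_run X m -> s z.1 != z.2 :> nat) ->
  exists2 x, x \in X & ~~ (m <= s x < m + D).
Proof.
case/set0Pn => x0 x0X; rewrite /witness_run; case: pickP => [x xX h|/(_ x0)]; last by rewrite x0X.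
exists x => //; apply/negP => /andP[h1 h2].
have : (x, s x : nat) \in [seq (x, m + t) | t <- iota 0 D].
  by apply/mapP; exists (s x - m); [rewrite mem_iota; lia | rewrite subnKC].
by move/h; rewrite /= eqxx.
Qed.

Lemma step_up : (forall C, C \in W -> #|C| <= #|A| + D) ->
  exists2 s, s \in R & forall B, s \in through B -> A \proper B -> #|B| <= #|A| + D ->
    B \notin Forb /\ forall C, C \in W -> (C \subset B -> C \subset A) /\ ~~ (B \subset C).
Proof.
move=> Wsz.
(* The first list keeps some element of $C\setminus A$ out of the first $|A|+D$ positions, hence out
   of [B]. The second acts when $A\subseteq C$: the element acquired just after [A] is then not in
   [C], so $B\not\subseteq C$. *)
pose Zf C := witness_run (C :\: A) #|A| ++
   (if A \subset C then [seq (x, #|A|) | x <- enum (C :\: A)] else [::]).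
have [C|s sR [sF sZ]] := @avoid_family Zf.
  case: ifP => // CW; rewrite size_cat mul2n -addnn leq_add ?size_witness_run //.
  case: ifP => // hAC; rewrite size_map -cardE cardsD (setIidPr hAC).
  by have := Wsz C CW; lia.
exists s => // B inB AB Bsz.
have /throughP sA' : s \in through A by apply: (subsetP RA).
have /throughP sB' := inB.
split; first by apply/negP => BF; have := sF B BF; rewrite AB inB => /(_ isT).
move=> C CW; split=> [CB|].
  apply/negPn; rewrite -setD_eq0; apply/negP => CA.
  have [|x] := @witness_runP _ #|A| s CA.
    by move=> z zZ; apply: (sZ C) => //; rewrite mem_cat zZ.
  rewrite inE sA' -leqNgt => /andP[Ax xC]; rewrite Ax /= -leqNgt => h.
  have := subsetP CB _ xC; rewrite sB' => h2.
  by have := leq_trans (leq_trans h2 Bsz) h; rewrite ltnn.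
apply/negP => BC.
have AltB := proper_card AB.
have An : #|A| < n by apply: leq_trans AltB (card_le_n B).
pose x := (s^-1)%g (Ordinal An).
have sx : s x = #|A| :> nat by rewrite permKV.
have xB : x \in B by rewrite sB' sx.
have := sZ C (x, #|A|) CW; rewrite /= sx eqxx => h; apply/notF/h.
rewrite mem_cat (subset_trans (proper_sub AB) BC); apply/orP; right; apply: map_f.
by rewrite mem_enum inE (subsetP BC) // sA' sx ltnn.
Qed.

Lemma step_down : (forall C, C \in W -> #|A| <= #|C| + D) ->
  exists2 s, s \in R & forall B, s \in through B -> B \proper A -> #|A| <= #|B| + D ->
    B \notin Forb /\ forall C, C \in W -> (B \subset C -> A \subset C) /\ ~~ (C \subset B).
Proof.
move=> Wsz.
(* Dually, some element of $A\setminus C$ is acquired before position $|A|-D$, hence lies in [B];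
   and when $C\subseteq A$, the last element acquired by [A], at position $|A|-1$, lies in [C] but
   not in [B]. *)
pose Zf C := witness_run (A :\: C) (#|A| - D) ++
   (if C \subset A then [seq (x, #|A|.-1) | x <- enum (A :\: C)] else [::]).
have [C|s sR [sF sZ]] := @avoid_family Zf.
  case: ifP => // CW; rewrite size_cat mul2n -addnn leq_add ?size_witness_run //.
  case: ifP => // hAC; rewrite size_map -cardE cardsD (setIidPr hAC).
  by have := Wsz C CW; lia.
exists s => // B inB AB Bsz.
have /throughP sA' : s \in through A by apply: (subsetP RA).
have /throughP sB' := inB.
split; first by apply/negP => BF; have := sF B BF; rewrite AB inB orbT => /(_ isT).
move=> C CW; split=> [CB|].
  apply/negPn; rewrite -setD_eq0; apply/negP => CA.
  have [|x] := @witness_runP _ (#|A| - D) s CA.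
    by move=> z zZ; apply: (sZ C) => //; rewrite mem_cat zZ.
  rewrite inE => /andP[xC]; rewrite sA' => sxA h.
  have : x \in B by rewrite sB'; lia.
  by move/(subsetP CB); rewrite (negbTE xC).
apply/negP => BC.
have AltB := proper_card AB.
have An : #|A|.-1 < n by have := card_le_n A; lia.
pose x := (s^-1)%g (Ordinal An).
have sx : s x = #|A|.-1 :> nat by rewrite permKV.
have xB : x \notin B by rewrite sB' sx; lia.
have := sZ C (x, #|A|.-1) CW; rewrite /= sx eqxx => h; apply/notF/h.
rewrite mem_cat (subset_trans BC (proper_sub AB)); apply/orP; right; apply: map_f.
rewrite mem_enum inE sA' sx; apply/andP; split; last by lia.
by apply: contra xB; apply: (subsetP BC).
Qed.
End Step.

(** * Tree posets *)

Section AcyclicGraph.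
Variables (T : finType) (e : rel T).
Hypothesis e_sym : symmetric e.
Hypothesis acyclic : forall s : seq T, 3 <= size s -> ~~ (path.cycle e s && uniq s).
Implicit Types (S : {set T}) (u v w : T).

Definition connected_set S := forall x y, x \in S -> y \in S ->
  exists p, [/\ path e x p, last x p = y & {subset p <= S}].

Lemma connected_set1 x : connected_set [set x].
Proof. by move=> y z /set1P -> /set1P ->; exists [::]. Qed.

Lemma connected_setU1 S u v : connected_set S -> u \in S -> e u v -> connected_set (v |: S).
Proof.
move=> cS uS uv.
have sS (p : seq T) : {subset p <= S} -> {subset p <= v |: S} by move=> h z /h zS; rewrite inE zS orbT.
move=> x y /setU1P[->|xS] /setU1P[->|yS].
- by exists [::].
- have [p [ep lp pS]] := cS u y uS yS; exists (u :: p); split=> //=; first by rewrite e_sym uv.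
  by move=> z; rewrite inE => /orP[/eqP ->|/(sS p pS) //]; rewrite inE uS orbT.
- have [p [ep lp pS]] := cS x u xS uS; exists (rcons p v); split; rewrite ?last_rcons //.
    by rewrite rcons_path ep lp.
  by move=> z; rewrite mem_rcons inE => /orP[/eqP ->|/(sS p pS) //]; rewrite setU11.
- by have [p [ep lp pS]] := cS x y xS yS; exists p; split=> //; apply: sS.
Qed.

Lemma connected_exit S u w : (forall x y, connect e x y) -> u \in S -> w \notin S ->
  exists x y, [/\ x \in S, y \notin S & e x y].
Proof.
move=> con uS wS; have /connectP[p ep lp] := con u w.
elim: p u uS ep lp => [|y p IH] x xS /=; first by move=> _ wx; rewrite wx xS in wS.
case/andP=> xy ep lp; have [yS|yS] := boolP (y \in S); first exact: IH yS ep lp.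
by exists x, y.
Qed.

(** If [w] were not [u], the path outside [S], closed up by a simple path from [w] to [u] inside
    [S], would be a cycle with at least three vertices. *)
Lemma outside_path_exit S u v q w : connected_set S -> u \in S -> w \in S ->
    path e v q -> uniq (v :: q) -> {in v :: q, forall z, z \notin S} ->
  e u v -> e (last v q) w -> w = u.
Proof.
move=> cS uS wS vq uq qS uv lw; apply/eqP/negPn/negP => wu.
have [p0 [ep0 lp0 p0S]] := cS w u wS uS.
case/shortenP: ep0 lp0 => p ep up pp0 lp.
have pS : {subset w :: p <= S}.
  by move=> z; rewrite inE => /orP[/eqP -> //|/pp0 /p0S].
have sp : 0 < size p by case: (p) lp wu => //= ->; rewrite eqxx.
have big : 3 <= size ((v :: q) ++ w :: p) by rewrite size_cat /= !addSn addnS !ltnS ltn_addl.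
apply/notF; rewrite -(negbTE (acyclic big)).
apply/andP; split.
  rewrite /= rcons_cat /= cat_path /= vq lw rcons_path ep lp uv //.
rewrite cat_uniq uq up andbT andTb; apply/hasPn => z zp; apply/negP => zq.
by have := qS z zq; rewrite pS.
Qed.
End AcyclicGraph.

(** * Covers in a finite strict order, for use with an order and its dual *)

Section StrictOrder.
Variables (T : finType) (lt : rel T).
Hypotheses (lt_irr : irreflexive lt) (lt_tr : transitive lt).

Definition cover_rel x y := lt x y && [forall z, ~~ (lt x z && lt z y)].

(** Among the elements [c] below [z] with $c=w$ or $w<c$, one with the most elements below it is
    covered by [z]. *)
Lemma exists_cover w z : lt w z -> exists c, cover_rel c z /\ (w = c \/ lt w c).
Proof.
move=> wz; pose Q c := ((w == c) || lt w c) && lt c z.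
have Qw : Q w by rewrite /Q eqxx wz.
case: (arg_maxnP (fun c => #|[set y | lt y c]|) Qw) => c /andP[wc cz] cmax.
exists c; split; last by case/orP: wc => [/eqP|]; [left|right].
rewrite /cover_rel cz; apply/forallP => y; apply/negP => /andP[cy yz].
have Qy : Q y.
  by rewrite /Q yz andbT; apply/orP; right; case/orP: wc => [/eqP -> //|wc]; apply: lt_tr cy.
have := cmax y Qy; rewrite /= leqNgt => /negP; apply; apply: proper_card.
apply/properP; split; first by apply/subsetP => x; rewrite !inE => xc; apply: lt_tr cy.
by exists c; rewrite !inE ?lt_irr.
Qed.

Variable e : rel T.
Hypothesis acyclic : forall s : seq T, 3 <= size s -> ~~ (path.cycle e s && uniq s).
Hypothesis cover_e : forall x y, cover_rel x y -> e y x.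

(* Descend from [v] to [w] along covers: the descent must enter [S] at [u]. *)
Lemma below_outside S u v w : connected_set e S -> u \in S -> v \notin S -> e u v ->
  w \in S -> lt w v -> (w = u \/ lt w u) /\ lt u v.
Proof.
move=> cS uS vS uv wS.
suff h m z q : #|[set y | lt y z]| <= m -> path (fun a b => cover_rel b a) v q -> last v q = z ->
    {in v :: q, forall x, x \notin S} -> (z = v \/ lt z v) -> lt w z -> (w = u \/ lt w u) /\ lt u v.
  by apply: (h _ v [::] (leqnn _)) => // [x|]; [rewrite inE => /eqP -> | left].
elim: m z q => [|m IH] z q.
  rewrite leqn0 cards_eq0 => /eqP z0 _ _ _ _ wz.
  by move: (in_set0 w); rewrite -z0 inE wz.
move=> cz vq lq qS zv /exists_cover[c [cc wc]].
have cz' : lt c z by case/andP: cc.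
have cv : lt c v by case: zv => [<-|] //; apply: lt_tr.
have [cS'|cS'] := boolP (c \in S).
  have cu : c = u.
    apply: (outside_path_exit acyclic cS uS cS' _ _ qS uv).
    - by apply: sub_path vq => a b; apply: cover_e.
    - apply: (@sorted_uniq _ (fun a b => lt b a)) => [b a x h1 h2|//|]; first exact: lt_tr h1.
      by apply: sub_path vq => a b /andP[].
    - by rewrite lq; apply: cover_e.
  by rewrite -cu.
have wc' : lt w c by case: wc => // wc; rewrite -wc wS in cS'.
apply: (IH c (rcons q c)) => //.
- rewrite -ltnS; apply: leq_trans cz; apply: proper_card; apply/properP; split.
    by apply/subsetP => x; rewrite !inE => xc; apply: lt_tr cz'.
  by exists c; rewrite !inE ?lt_irr.
- by rewrite rcons_path vq lq.
- by rewrite last_rcons.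
- by move=> x; rewrite -rcons_cons mem_rcons inE => /orP[/eqP ->|/qS].
- by right.
Qed.
End StrictOrder.

(** * Comparabilities and ranks in a tree poset *)

Section TreePoset.
Import Order.TTheory.
Variables (d : Order.disp_t) (P : finPOrderType d).
Hypothesis treeP : @tree_poset d P.
Implicit Types (S : {set P}) (u v w : P).

Lemma hasse_adj_sym : symmetric (@hasse_adj d P).
Proof. by move=> x y; rewrite /hasse_adj orbC. Qed.

(** Every comparability between [S] and the new vertex [v] passes through the neighbour [u], so the
    relations required of the image of [v] follow from its relation to the image of [u]. *)
Lemma tree_below S u v w : connected_set (@hasse_adj d P) S -> u \in S -> v \notin S ->
  hasse_adj u v -> w \in S -> (w < v)%O -> (w <= u)%O /\ (u < v)%O.
Proof.
case: treeP => _ _ acy cS uS vS uv wS wv.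
have [] := @below_outside P (fun x y => (x < y)%O) _ _ (@hasse_adj d P) acy _ S u v w cS uS vS uv wS wv.
- by move=> x; apply: ltxx.
- by move=> y x z; apply: lt_trans.
- by move=> x y xy; apply/orP; right.
by move=> [->|/ltW] ->.
Qed.

(** This is [below_outside] for the dual order, whose covers are those of [P] reversed. *)
Lemma tree_above S u v w : connected_set (@hasse_adj d P) S -> u \in S -> v \notin S ->
  hasse_adj u v -> w \in S -> (v < w)%O -> (u <= w)%O /\ (v < u)%O.
Proof.
case: treeP => _ _ acy cS uS vS uv wS wv.
have [] := @below_outside P (fun x y => (y < x)%O) _ _ (@hasse_adj d P) acy _ S u v w cS uS vS uv wS wv.
- by move=> x; apply: ltxx.
- by move=> y x z h1 h2; apply: lt_trans h1.
- move=> x y /andP[yx /forallP h]; apply/orP; left; rewrite /covers yx; apply/forallP => z.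
  by rewrite andbC.
by move=> [->|/ltW] ->.
Qed.

(** The rank counted from 0: only chains strictly below [x] are measured, so that the values stay
    below the height. *)
Definition prank (x : P) : nat := \max_(C : {set P} | is_chain C && [forall y in C, (y < x)%O]) #|C|.

Lemma chain_setU1 (C : {set P}) x : is_chain C -> [forall y in C, (y < x)%O] ->
  is_chain (x |: C) /\ #|x |: C| = #|C|.+1.
Proof.
move=> chC /forall_inP Cx; split; last first.
  by rewrite cardsU1; case: (boolP (x \in C)) => // /Cx; rewrite ltxx.
apply/forall_inP => y /setU1P[->|yC]; apply/forall_inP => z /setU1P[->|zC].
- by rewrite lexx.
- by rewrite (ltW (Cx z zC)) orbT.
- by rewrite (ltW (Cx y yC)).
- by have /forall_inP/(_ z zC) := forall_inP chC y yC.
Qed.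

Lemma prank_max x : exists2 C : {set P}, is_chain C && [forall y in C, (y < x)%O] & prank x = #|C|.
Proof.
pose Q (C : {set P}) := is_chain C && [forall y in C, (y < x)%O].
have Q0 : 0 < #|Q|.
  apply/card_gt0P; exists set0; rewrite unfold_in.
  by apply/andP; split; apply/forall_inP => y; rewrite inE.
by have [C QC e] := eq_bigmax_cond (fun C : {set P} => #|C|) Q0; exists C.
Qed.

Lemma prank_height x : prank x < @height d P.
Proof.
have [C /andP[chC Cx] ->] := prank_max x.
have [chU <-] := chain_setU1 chC Cx; exact: (@leq_bigmax_cond _ _ (fun C : {set P} => #|C|) _ chU).
Qed.

Lemma prank_lt x y : (x < y)%O -> prank x < prank y.
Proof.
move=> xy; have [C /andP[chC Cx] ->] := prank_max x.
have [chU <-] := chain_setU1 chC Cx.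
apply: (@leq_bigmax_cond _ _ (fun C : {set P} => #|C|)); rewrite chU /=.
apply/forall_inP => z /setU1P[-> //|zC]; apply: lt_trans xy; exact: (forall_inP Cx).
Qed.
End TreePoset.

(** * Robust embedding *)

Section Embedding.
Import Order.TTheory.
Variables (d : Order.disp_t) (P : finPOrderType d).
Hypothesis treeP : @tree_poset d P.
Variables (n e l D : nat) (F : {set {set 'I_n}}).
Local Notation k := (@height d P).
Local Notation q := (2 * k * (e * k.-1 + 1)).
Hypotheses (sizeF : (e * k.-1 + 1) * 'C(n, n./2) <= e * #|F|) (gapF : gapped l F).
Hypotheses (Flo : forall A, A \in F -> n <= 3 * #|A|) (Fhi : forall A, A \in F -> n <= 3 * (n - #|A|)).
Hypothesis FD : forall A B, A \in F -> B \in F -> #|A| <= #|B| + D.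
Hypotheses (n0 : 0 < n) (ln : 6 * l <= n) (Dn : 3 * (D + l) <= n) (qn : 18 * q * #|P| * D <= n).
(** [good] will mean that no nonempty subset is saturated; the embedding uses that singletons are
    good and that good sets have few bad one-point extensions. *)
Variable good : {set {set 'I_n}} -> bool.
Hypothesis good1 : forall A, A \in F -> good [set A].
Hypothesis goodU : forall W : {set {set 'I_n}}, W \subset F -> W != set0 -> good W -> #|W| < #|P| ->
  3 * q * (6 ^ l * l`!) * #|[set B in F | (B \notin W) && ~~ good (B |: W)]| <= n ^ l.

Definition rank (x : P) : 'I_k := Ordinal (prank_height x).

Definition partial_copy (L : 'I_k -> {set {set 'I_n}}) (S : {set P}) (f : P -> {set 'I_n}) :=
  [/\ forall x, x \in S -> f x \in L (rank x), {in S &, injective f},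
      {in S &, forall x y, (f x \proper f y) = (x < y)%O} & good (f @: S)].

Lemma partial_copy_extend L S f u v B : partial_copy L S f -> u \in S -> v \notin S ->
    B \in F -> B \in L (rank v) -> B \notin f @: S -> good (B |: f @: S) ->
    {in S, forall w, (f w \proper B) = (w < v)%O /\ (B \proper f w) = (v < w)%O} ->
  partial_copy L (v |: S) (fun x => if x == v then B else f x).
Proof.
move=> [fL fI fO fG] uS vS BF BL BW gB rel.
have nv x : x \in S -> (x == v) = false by move=> xS; apply: contraNF vS => /eqP <-.
split.
- by move=> x /setU1P[->|xS]; rewrite ?eqxx // nv // fL.
- move=> x y /setU1P[->|xS] /setU1P[->|yS]; rewrite ?eqxx ?nv //; last exact: fI.
    by move=> eB; case/negP: BW; rewrite eB imset_f.
  by move=> eB; case/negP: BW; rewrite -eB imset_f.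
- move=> x y /setU1P[->|xS] /setU1P[->|yS]; rewrite ?eqxx ?nv //.
  + by rewrite properxx ltxx.
  + by have [] := rel y yS.
  + by have [] := rel x xS.
  + exact: fO.
- rewrite imsetU1 eqxx (_ : [set _ | _ in S] = f @: S) //.
  by apply: eq_in_imset => x xS; rewrite nv.
Qed.

Lemma copy_avoiding : exists f : P -> {set 'I_n},
  [/\ injective f, forall x, f x \in F, forall x y, (f x \proper f y) = (x < y)%O &
      good (f @: [set: P])].
Proof.
have [P0 conP _] := treeP.
have [x0 _] := card_gt0P P0.
have k0 : 0 < k by apply: leq_ltn_trans (prank_height x0).
have [L [LF L0 LR]] := prune k0 sizeF.
suff [S [f [cS _ [fL fI fO fG]]]] : exists (S : {set P}) (f : P -> {set 'I_n}),
    [/\ #|S| = #|P|, connected_set (@hasse_adj d P) S & partial_copy L S f].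
  have ST : S = setT by apply/eqP; rewrite eqEcard subsetT cardsT cS leqnn.
  rewrite ST in fL fI fO fG; exists f; split=> //.
  - by move=> x y; apply: fI; rewrite inE.
  - by move=> x; apply: (subsetP (LF (rank x))); apply: fL; rewrite inE.
  - by move=> x y; apply: fO; rewrite inE.
suff step m : 0 < m <= #|P| -> exists (S : {set P}) (f : P -> {set 'I_n}),
    [/\ #|S| = m, connected_set (@hasse_adj d P) S & partial_copy L S f].
  by apply: step; rewrite P0 leqnn.
elim: m => // m IH /andP[_ mP].
have [m0|m0] := posnP m.
  have [A AL] := set0Pn _ (L0 (rank x0)).
  exists [set x0], (fun => A); rewrite cards1 m0; split=> //; first exact: connected_set1.
  split.
  - by move=> x /set1P ->.
  - by move=> x y /set1P -> /set1P ->.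
  - by move=> x y /set1P -> /set1P ->; rewrite properxx ltxx.
  - rewrite imset_set1; apply: good1; exact: (subsetP (LF (rank x0))).
have [|S [f [cS conS pc]]] := IH; first by rewrite m0 ltnW.
have [fL fI fO fG] := pc.
have [a aS] : exists a, a \in S by apply/set0Pn; rewrite -cards_eq0 cS -lt0n.
have [b bS] : exists b, b \notin S.
  have : ~: S != set0 by rewrite -cards_eq0 cardsCs setCK cS; rewrite -lt0n subn_gt0.
  by case/set0Pn => b; rewrite inE; exists b.
have [u [v [uS vS uv]]] := connected_exit conP aS bS.
have fF w : w \in S -> f w \in F by move=> wS; apply: (subsetP (LF (rank w))); apply: fL.
pose W := f @: S.
have WF : W \subset F by apply/subsetP => _ /imsetP[w wS ->]; apply: fF.
have cW : #|W| = m by rewrite card_in_imset.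
have W0 : W != set0 by rewrite -cards_eq0 cW -lt0n.
pose A := f u; have AF : A \in F := fF u uS.
have AW : A \in W by apply: imset_f.
pose Forb := [set B in F | (B \notin W) && ~~ good (B |: W)].
have cForb : 3 * q * (6 ^ l * l`!) * #|Forb| <= n ^ l by apply: goodU; rewrite ?cW.
have [R [AR HR]] := LR _ _ (fL u uS).
have RA : R \subset through A by apply/subsetP => s /HR[].
have gF B : B \in Forb -> (A \proper B -> l <= #|B| - #|A| <= D) /\
                       (B \proper A -> l <= #|A| - #|B| <= D).
  rewrite inE => /andP[BF _]; split=> h; apply/andP; split; try by rewrite leq_subLR FD.
    by have := gapF AF BF h; rewrite cardsD (setIidPr (proper_sub h)).
  by have := gapF BF AF h; rewrite cardsD (setIidPr (proper_sub h)).
have WD C : C \in W -> C \in F by apply: (subsetP WF).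
have Wm : #|W| <= #|P| by rewrite cW ltnW.
suff [B [BL BForb rel]] : exists B, [/\ B \in L (rank v), B \notin Forb &
    {in S, forall w, [/\ (f w \proper B) = (w < v)%O, (B \proper f w) = (v < w)%O & B != f w]}].
  have BF : B \in F by apply: (subsetP (LF (rank v))).
  have BW : B \notin W.
    by apply/negP => /imsetP[w wS BE]; have [_ _] := rel w wS; rewrite BE eqxx.
  exists (v |: S), (fun x => if x == v then B else f x); split.
  - by rewrite cardsU1 vS cS.
  - exact (connected_setU1 (@hasse_adj_sym d P) conS uS uv).
  - apply: (partial_copy_extend pc uS vS BF BL BW).
      by move: BForb; rewrite inE BF BW /= negbK.
    by move=> w wS; have [] := rel w wS.
have below := tree_below treeP conS uS vS uv; have above := tree_above treeP conS uS vS uv.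
have fsub w : w \in S -> (f w \subset A) = (w <= u)%O.
  move=> wS; rewrite le_eqVlt -fO // subEproper; congr (_ || _).
  by apply/eqP/eqP => [/fI|->] //; apply.
have fsup w : w \in S -> (A \subset f w) = (u <= w)%O.
  move=> wS; rewrite le_eqVlt -fO // subEproper; congr (_ || _).
  by apply/eqP/eqP => [/fI|<-] //; apply.
(* When $u<v$ the ranks increase, so the chain meets [L (rank v)] strictly above [A]. By [step_up],
   [B] then contains just the images contained in [A] and is contained in none; in [P], [v] is above
   just the vertices of [S] that are at most [u] and below none. *)
case/orP: (uv) => /andP[lt_uv _].
  have [|s sR sB] := step_up RA AR (Flo AF) (Fhi AF) ln Dn n0 gF cForb Wm qn.
    by move=> C /WD CF; apply: FD.
  have [_ /(_ (rank v))[B [BL thB AB _]]] := HR s sR.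
  have {}AB := AB (prank_lt lt_uv).
  have BF : B \in F by apply: (subsetP (LF (rank v))).
  have [BForb BWr] := sB B thB AB (FD BF AF).
  exists B; split=> // w wS; have [r1 r2] := BWr (f w) (imset_f f wS).
  split.
  - apply/idP/idP => [/proper_sub/r1|wv]; first by rewrite fsub // => wu; apply: le_lt_trans lt_uv.
    by apply: sub_proper_trans AB; rewrite fsub //; case: (below w wS wv).
  - apply/idP/idP => [/proper_sub|vw]; first by rewrite (negbTE r2).
    by case: (above w wS vw) => _ vu; have := lt_trans lt_uv vu; rewrite ltxx.
  - by apply: contraNneq r2 => ->.
have [|s sR sB] := step_down RA AR (Flo AF) (Fhi AF) ln Dn n0 gF cForb Wm qn.
  by move=> C /WD CF; apply: FD.
have [_ /(_ (rank v))[B [BL thB _ BA]]] := HR s sR.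
have {}BA := BA (prank_lt lt_uv).
have BF : B \in F by apply: (subsetP (LF (rank v))).
have [BForb BWr] := sB B thB BA (FD AF BF).
exists B; split=> // w wS; have [r1 r2] := BWr (f w) (imset_f f wS).
split.
- apply/idP/idP => [/proper_sub|wv]; first by rewrite (negbTE r2).
  by case: (below w wS wv) => _ vu; have := lt_trans lt_uv vu; rewrite ltxx.
- apply/idP/idP => [/proper_sub/r1|wv]; first by rewrite fsup // => wu; apply: lt_le_trans wu.
  by apply: proper_sub_trans BA _; rewrite fsup //; case: (above w wS wv).
- by apply: contraNneq r2 => ->.
Qed.
End Embedding.

(** * Greedy construction *)

Lemma card_bigcup_le (I T : finType) (X : {set I}) (G : I -> {set T}) c :
  (forall i, i \in X -> #|G i| <= c) -> #|\bigcup_(i in X) G i| <= #|X| * c.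
Proof.
move=> hG; rewrite -sum_nat_const.
elim/big_rec2: _ => [|i a b iX IH]; first by rewrite cards0.
by rewrite cardsU; apply: (leq_trans (leq_subr _ _)); rewrite leq_add ?hG.
Qed.

Section Greedy.
Variables (d : Order.disp_t) (P : finPOrderType d).
Hypothesis treeP : @tree_poset d P.
Variables (n e l D t : nat) (F : {set {set 'I_n}}).
Local Notation k := (@height d P).
Local Notation p := #|P|.
Local Notation m := (n ^ l).
Local Notation q := (2 * k * (2 * e * k.-1 + 1)).
Local Notation K := (3 * q * (6 ^ l * l`!)).
Hypotheses (sizeF : (e * k.-1 + 1) * 'C(n, n./2) <= e * #|F|) (gapF : gapped l F).
Hypotheses (Flo : forall A, A \in F -> n <= 3 * #|A|) (Fhi : forall A, A \in F -> n <= 3 * (n - #|A|)).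
Hypothesis FD : forall A B, A \in F -> B \in F -> #|A| <= #|B| + D.
Hypotheses (n0 : 0 < n) (ln : 6 * l <= n) (Dn : 3 * (D + l) <= n) (qn : 18 * q * p * D <= n).
Hypotheses (t0 : 0 < t) (te : 4 * e * p <= t) (tK : K * (2 ^ p * (2 * p)) <= t) (tm : 2 * t <= m).
Implicit Types (H : {set {set {set 'I_n}}}) (W E X : {set {set 'I_n}}).

(** The second clause is $\deg_H(X)\le(\delta n^l)^{p-|X|}$ with $\delta=1/t$, free of
    denominators. *)
Definition balanced H :=
  (forall E, E \in H -> @induced_copy d P n F E) /\
  (forall X, 1 <= #|X| <= p -> hdeg H X * t ^ (p - #|X|) <= m ^ (p - #|X|)).

Definition saturated H X := m ^ (p - #|X|) < (hdeg H X).+1 * t ^ (p - #|X|).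

Definition saturating H X : {set {set 'I_n}} := [set B | (B \notin X) && saturated H (B |: X)].

Definition unsaturated H W :=
  [forall X : {set {set 'I_n}}, (X \subset W) && (X != set0) ==> ~~ saturated H X].

Lemma card_induced_copy E : @induced_copy d P n F E -> #|E| = p.
Proof. by case=> f [fI _ _ ->]; rewrite card_imset // cardsT. Qed.

(** Since $2t\le m$, the one extra edge accounts for at most half of the bound; in exponent 0
    saturation already means a positive degree. *)
Lemma saturated_deg H X : saturated H X -> m ^ (p - #|X|) <= 2 * hdeg H X * t ^ (p - #|X|).
Proof.
rewrite /saturated; case: (p - #|X|) => [|i]; first by rewrite !expn0; lia.
have : 2 * t ^ i.+1 <= m ^ i.+1.
  rewrite !expnS mulnA; apply: leq_mul => //.
  by elim: i => // i IH; rewrite !expnS leq_mul //; lia.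
rewrite mulSn -mulnA; lia.
Qed.

Lemma sum_hdeg H X : (forall E, E \in H -> @induced_copy d P n F E) ->
  \sum_(B in ~: X) hdeg H (B |: X) <= p * hdeg H X.
Proof.
move=> cH.
rewrite (eq_bigr (fun B => #|[set E in [set E in H | X \subset E] | B \in E]|)); last first.
  by move=> B _; apply: eq_card => E; rewrite !inE subUset sub1set andbA andbAC.
apply: sum_card_le => E; rewrite inE => /andP[EH _].
by rewrite -(card_induced_copy (cH E EH)); apply/subset_leq_card/subsetP => B; rewrite inE => /andP[].
Qed.

(** Each saturating set extends [X] to a set with at least half the maximal degree, and by
    [sum_hdeg] these degrees add up to at most $p\deg_H(X)$. *)
Lemma card_saturating H X : balanced H -> #|X| < p ->
  #|saturating H X| * m ^ (p - #|X|).-1 <= 2 * p * hdeg H X * t ^ (p - #|X|).-1.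
Proof.
case=> cH _ Xp; set i := _.-1.
apply: (@leq_trans (\sum_(B in saturating H X) 2 * hdeg H (B |: X) * t ^ i)).
  rewrite -sum_nat_const; apply: leq_sum => B; rewrite inE => /andP[BX /saturated_deg].
  by rewrite cardsU1 BX /i -subn1 -subnDA addnC.
rewrite -big_distrl -big_distrr /= leq_mul2r -mulnA leq_mul2l; apply/orP; right.
apply: leq_trans (sum_hdeg X cH).
rewrite [X in _ <= X](big_setID (saturating H X)) /=.
rewrite (_ : ~: X :&: saturating H X = saturating H X) ?leq_addr //.
by apply/setIidPr/subsetP => B; rewrite !inE => /andP[].
Qed.

(** Here the degree of [X] is itself at most $(m/t)^{p-|X|}$, since [H] is balanced. *)
Lemma card_saturating_nonempty H X : balanced H -> 0 < #|X| < p -> t * #|saturating H X| <= 2 * p * m.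
Proof.
move=> bH /andP[X0 Xp]; have h := card_saturating bH Xp.
have := bH.2 X; rewrite X0 ltnW // => /(_ isT).
have -> : p - #|X| = (p - #|X|).-1.+1 by rewrite prednK // subn_gt0.
move: h; rewrite /=; set i := _.-1 => h; rewrite !expnS => h2.
have mi : 0 < m ^ i by rewrite !expn_gt0 n0.
rewrite -(leq_pmul2r mi).
have h3 := leq_mul (leqnn t) h; have h4 := leq_mul (leqnn (2 * p)) h2.
move: h3 h4; move: (n ^ l) (t ^ i) (m ^ i) (hdeg H X) #|saturating H X| => N a b c s; nia.
Qed.

(** For empty [X] the degree is $|H|$, which is still below its target. *)
Lemma card_saturating0 H : 0 < p -> balanced H -> t ^ p * #|H| < m ^ p.-1 * 'C(n, n./2) ->
  t * #|saturating H set0| <= 2 * p * 'C(n, n./2).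
Proof.
move=> p0 bH Hlt; have := @card_saturating H set0 bH; rewrite cards0 subn0 => /(_ p0) h.
have hd : hdeg H set0 = #|H| by apply: eq_card => E; rewrite inE sub0set andbT.
rewrite hd in h.
have mi : 0 < m ^ p.-1 by rewrite !expn_gt0 n0.
rewrite -(leq_pmul2r mi).
have h3 := leq_mul (leqnn t) h; have h4 := leq_mul (leqnn (2 * p)) (ltnW Hlt).
have tp : t ^ p = t * t ^ p.-1 by rewrite -expnS prednK.
rewrite tp in h4; move: h3 h4; move: (t ^ p.-1) (m ^ p.-1) 'C(_, _) => a b c; lia.
Qed.

Lemma greedy_step H : balanced H -> t ^ p * #|H| < m ^ p.-1 * 'C(n, n./2) ->
  exists2 E, E \notin H & balanced (E |: H).
Proof.
move=> bH Hlt; have [p0 _ _] := treeP.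
pose F' := F :\: saturating H set0.
have F'F : F' \subset F by apply: subsetDl.
have inF A : A \in F' -> A \in F by apply: (subsetP F'F).
(* Discarding saturated singletons removes at most $\binom n{\lfloor n/2\rfloor}/(2e)$ members,
   which at worst halves the excess $1/e$ over $k-1$; hence the parameter [2 * e]. *)
have sizeF' : (2 * e * k.-1 + 1) * 'C(n, n./2) <= 2 * e * #|F'|.
  have h := card_saturating0 p0 bH Hlt.
  have h1 : 4 * e * p * #|saturating H set0| <= 2 * p * 'C(n, n./2).
    by apply: leq_trans h; rewrite leq_mul2r te orbT.
  have h2 : 2 * e * #|saturating H set0| <= 'C(n, n./2).
    have p20 : 0 < 2 * p by lia.
    by rewrite -(leq_pmul2l p20); apply: leq_trans h1; lia.
  have h3 : #|F| <= #|F'| + #|saturating H set0|.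
    by rewrite -(cardsID (saturating H set0) F) addnC leq_add2l subset_leq_card // subsetIr.
  have h4 := leq_mul (leqnn (2 * e)) h3; rewrite mulnDr in h4.
  move: sizeF h2 h4; move: #|F| #|F'| #|saturating H set0| 'C(n, n./2) => f f' s c; lia.
have [|||||| f [fI fF fO fG]] :=
  @copy_avoiding d P treeP n (2 * e) l D F' sizeF' _ _ _ _ n0 ln Dn qn (unsaturated H).
- by move=> A B /inF AF /inF BF; apply: gapF.
- by move=> A /inF; apply: Flo.
- by move=> A /inF; apply: Fhi.
- by move=> A B /inF AF /inF; apply: FD.
- move=> A; rewrite !inE /= setU0 => /andP[ns _].
  apply/forallP => X; apply/implyP => /andP[XA X0].
  by move: XA; rewrite subset1 (negbTE X0) orbF => /eqP ->.
- move=> W WF' W0 goodW Wp.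
  set Y := [set B in F' | _].
  (* If adding [B] creates a saturated [X], then [X] contains [B] because [W] has no saturated
     nonempty subset, and $X\setminus\{B\}$ is nonempty because saturated singletons were
     discarded. *)
  have sub : Y \subset \bigcup_(X in powerset W :\ set0) saturating H X.
    apply/subsetP => B; rewrite inE => /and3P[BF' BW]; rewrite negb_forall => /existsP[X].
    rewrite negb_imply negbK => /andP[/andP[XBW X0] satX].
    have BX : B \in X.
      apply: contraT => BX; have := forallP goodW X; rewrite satX X0 andbT implybF => /negP; case.
      apply/subsetP => C CX; have := subsetP XBW _ CX; rewrite inE => /orP[/set1P CB|//].
      by rewrite CB in CX; rewrite CX in BX.
    apply/bigcupP; exists (X :\ B); last by rewrite inE setD11 setD1K.
    rewrite !inE subDset XBW andbT; apply/negP => /eqP XB0.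
    move: BF'; rewrite !inE /= setU0; case/andP => /negP; case.
    by rewrite -(setD1K BX) XB0 setU0 in satX.
  (* There are at most $2^p$ sets [X], each with at most $2pm/t$ saturating sets; [tK] turns this
     into the bound required of bad extensions. *)
  have cY : t * #|Y| <= 2 ^ p * (2 * p * m).
    apply: (leq_trans (leq_mul (leqnn _) (subset_leq_card sub))).
    have [c hc] : exists c, c = 2 * p * m %/ t by exists (2 * p * m %/ t).
    apply: (@leq_trans (t * (2 ^ p * c))).
      rewrite leq_mul2l; apply/orP; right.
      apply: (leq_trans (@card_bigcup_le _ _ _ _ c _)).
        move=> X; rewrite !inE => /andP[X0 XW]; rewrite hc leq_divRL // mulnC.
        apply: card_saturating_nonempty => //; rewrite card_gt0 X0.
        by apply: leq_ltn_trans Wp; apply: subset_leq_card.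
      rewrite leq_mul2r; apply/orP; right.
      apply: (@leq_trans #|powerset W|); first by apply/subset_leq_card/subsetDl.
      by rewrite card_powerset leq_exp2l // ltnW.
    by rewrite mulnCA leq_mul2l hc mulnC leq_trunc_div orbT.
  have c0 : 0 < 2 ^ p * (2 * p) by rewrite !muln_gt0 expn_gt0 p0.
  rewrite -(leq_pmul2r c0).
  have := leq_mul tK (leqnn #|Y|); move: cY; move: (2 ^ p) K #|Y| (n ^ l) => a b y N; nia.
set E := f @: _ in fG.
have cE : #|E| = p by rewrite card_imset // cardsT.
have E0 : E != set0 by rewrite -card_gt0 cE.
have uns X : X \subset E -> X != set0 -> ~~ saturated H X.
  by move=> XE X0; have := forallP fG X; rewrite XE X0.
exists E.
  (* An edge of [H] is saturated, since its own degree is at least $1=m^0$; hence [E] is new. *)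
  apply: contra (uns E (subxx _) E0) => EH; rewrite /saturated cE subnn !expn0 muln1 ltnS.
  by rewrite card_gt0; apply/set0Pn; exists E; rewrite inE EH subxx.
split=> [E'|X Xc].
  case/setU1P => [->|/bH.1 //]; exists f; split=> // x; exact: inF (fF x).
have dE : hdeg (E |: H) X <= (X \subset E) + hdeg H X.
  rewrite /hdeg; case: (boolP (X \subset E)) => XE.
    apply: (@leq_trans #|E |: [set E' in H | X \subset E']|).
      by apply/subset_leq_card/subsetP => E'; rewrite !inE => /andP[/orP[->//|->] ->]; rewrite orbT.
    by rewrite cardsU1 leq_add2r leq_b1.
  apply/subset_leq_card/subsetP => E'; rewrite !inE => /andP[/orP[/eqP -> XE'|-> ->//]].
  by rewrite XE' in XE.
apply: (leq_trans (leq_mul dE (leqnn _))).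
case: (boolP (X \subset E)) => XE; last exact: bH.2.
by rewrite leqNgt; apply: uns => //; rewrite -card_gt0; case/andP: Xc.
Qed.

(** The greedy step is iterated until the target is met; [T] steps always suffice because
    $t^p\ge1$. *)
Lemma balanced_supersaturation : exists H, balanced H /\ m ^ p.-1 * 'C(n, n./2) <= t ^ p * #|H|.
Proof.
set T := m ^ _ * _.
suff h N : exists H, balanced H /\ (N <= #|H| \/ T <= t ^ p * #|H|).
  have [H [bH TH]] := h T; exists H; split=> //; case: TH => // TH.
  by apply: (leq_trans TH); apply: leq_pmull; rewrite expn_gt0 t0.
elim: N => [|N [H [bH [NH|TH]]]].
- exists set0; split; last by left.
  split=> [E|X _]; first by rewrite inE.
  by rewrite (_ : hdeg _ _ = 0) //; apply/eqP; rewrite cards_eq0; apply/eqP/setP => E; rewrite !inE.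
- have [TH|TH] := leqP T (t ^ p * #|H|); first by exists H; split=> //; right.
  have [E EH bE] := greedy_step bH TH.
  by exists (E |: H); split=> //; left; rewrite cardsU1 EH add1n ltnS.
- by exists H; split=> //; right.
Qed.
End Greedy.

(** * The theorem over the reals *)

Section RealEstimates.
Local Open Scope R_scope.

Lemma INR_addn a b : INR (a + b)%N = INR a + INR b. Proof. exact: plus_INR. Qed.
Lemma INR_muln a b : INR (a * b)%N = INR a * INR b. Proof. exact: mult_INR. Qed.
Lemma INR_expn a b : INR (a ^ b)%N = pow (INR a) b.
Proof. by elim: b => // b IH; rewrite expnS INR_muln IH. Qed.
Lemma INR_leq a b : (a <= b)%N <-> INR a <= INR b.
Proof. by split => [/leP/le_INR //|/INR_le/leP]. Qed.
Lemma INR_ltn a b : (a < b)%N <-> INR a < INR b.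
Proof. by split => [/ltP/lt_INR //|/INR_lt/ltP]. Qed.

(** With $r=\sqrt n$ the bound $\ln r<r$ gives $n\ln n\le2nr$, and $r\ge8Q^2$ makes this at most
    $(n/(2Q))^2$. *)
Lemma sqrt_nlogn_small (Q : nat) : (0 < Q)%N -> exists N, forall n, (N <= n)%N ->
  INR Q * (2 * sqrt (INR n * ln (INR n))) <= INR n.
Proof.
move=> Q0; exists ((8 * Q * Q) ^ 2)%N => n /INR_leq; rewrite INR_expn !INR_muln.
have Q1 : 1 <= INR Q by apply: (proj1 (INR_leq 1 Q)).
have -> : INR 8 = 8 by rewrite /=; lra.
move: (INR Q) Q1 (INR n) => {Q0}Q Q1 {}n hn.
have b0 : 0 < 8 * Q * Q by nra.
have n0 : 0 < n by nra.
set r := sqrt n.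
have r0 : 0 < r by apply: sqrt_lt_R0.
have rr : r * r = n by apply: sqrt_sqrt; lra.
have br : 8 * Q * Q <= r.
  rewrite -(sqrt_pow2 (8 * Q * Q)); last lra.
  exact: sqrt_le_1_alt.
have lr : ln r < r.
  rewrite -{2}(ln_exp r); apply: ln_increasing => //.
  have := exp_ineq1 r; lra.
have lnn : ln n = 2 * ln r by rewrite -rr ln_mult //; lra.
have key : n * ln n <= (n / (2 * Q)) ^ 2.
  rewrite lnn; apply: (@Rle_trans _ (n * (2 * r))); first nra.
  have -> : (n / (2 * Q)) ^ 2 = n * (r * r / (4 * Q * Q)) by rewrite rr; field; lra.
  apply: Rmult_le_compat_l; first lra.
  have -> : 2 * r = r * (8 * Q * Q) / (4 * Q * Q) by field; lra.
  apply: Rmult_le_compat_r; first by apply: Rlt_le; apply: Rinv_0_lt_compat; nra.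
  by apply: Rmult_le_compat_l; lra.
have h : sqrt (n * ln n) <= n / (2 * Q).
  rewrite -(sqrt_pow2 (n / (2 * Q))); first exact: sqrt_le_1_alt.
  by apply: Rlt_le; apply: Rdiv_lt_0_compat; lra.
have Q2 : 0 <= 2 * Q by lra.
have := Rmult_le_compat_l (2 * Q) _ _ Q2 h.
have -> : 2 * Q * (n / (2 * Q)) = n by field; lra.
lra.
Qed.

(** The hypotheses give $||A|-n/2|<n/Q$, which is then multiplied by $2Q$. *)
Lemma middle_layers_close n Q (A : {set 'I_n}) : (0 < Q)%N ->
    INR Q * (2 * sqrt (INR n * ln (INR n))) <= INR n -> A \in middle_layers n ->
  (2 * Q * #|A| < Q * n + 2 * n /\ Q * n < 2 * Q * #|A| + 2 * n)%N.
Proof.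
move=> Q0 hQ; rewrite inE; case: Rlt_dec => // hA _.
have {Q0}Q1 : 1 <= INR Q by apply: (proj1 (INR_leq 1 Q)).
have [h1 h2] := Rabs_def2 _ _ hA.
have e2 : INR 2 = 2 by rewrite /=; lra.
rewrite e2 in h1 h2.
split; apply/INR_ltn; rewrite INR_addn !INR_muln !e2; nra.
Qed.

Lemma density_nat (k e C f : nat) eps : (0 < k)%N -> (0 < e)%N -> / INR e < eps ->
  (INR k - 1 + eps) * INR C <= INR f -> ((e * k.-1 + 1) * C <= e * f)%N.
Proof.
move=> k0 e0 he hf; apply/INR_leq; rewrite !INR_muln INR_addn INR_muln.
have -> : INR k.-1 = INR k - 1 by rewrite -{2}(prednK k0) S_INR; lra.
have e1 : 0 < INR e by apply: (lt_INR 0); apply/ltP.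
have ee : 1 < INR e * eps by have := Rmult_lt_compat_l _ _ _ e1 he; rewrite Rinv_r; lra.
have C0 := pos_INR C.
have := Rmult_le_compat_l (INR e) _ _ (Rlt_le _ _ e1) hf.
have -> : INR 1 = 1 by [].
nra.
Qed.

Lemma edge_bound_real (t n a p C h : nat) : (0 < t)%N -> (n ^ a * C <= t ^ p * h)%N ->
  (/ INR t) ^ p * (INR n ^ a * INR C) <= INR h.
Proof.
move=> t0 /INR_leq; rewrite !INR_muln !INR_expn => hle.
have t1 : 0 < INR t by apply: (lt_INR 0); apply/ltP.
have tp : 0 < INR t ^ p by apply: pow_lt.
rewrite pow_inv; apply: (Rmult_le_reg_l (INR t ^ p)) => //.
by rewrite -Rmult_assoc Rinv_r ?Rmult_1_l //; lra.
Qed.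

Lemma degree_bound_real (t n l i h : nat) : (0 < t)%N -> (h * t ^ i <= (n ^ l) ^ i)%N ->
  INR h <= (/ INR t * INR n ^ l) ^ i.
Proof.
move=> t0 /INR_leq; rewrite !INR_muln !INR_expn => hle.
have t1 : 0 < INR t by apply: (lt_INR 0); apply/ltP.
have tp : 0 < INR t ^ i by apply: pow_lt.
rewrite Rpow_mult_distr pow_inv; apply: (Rmult_le_reg_l (INR t ^ i)) => //.
by rewrite -Rmult_assoc Rinv_r ?Rmult_1_l ?[_ * INR h]Rmult_comm //; lra.
Qed.
End RealEstimates.

Theorem theorem5p5 :
  forall (d : Order.disp_t) (P : finPOrderType d) (k : nat),
  @tree_poset d P -> @height d P = k ->
  forall (eps : R), Rlt 0 eps ->
  forall (l : nat), 0 < l ->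
  exists delta : R, Rlt 0 delta /\
  exists N : nat, forall n : nat, N <= n ->
  forall F : {set {set 'I_n}},
    F \subset middle_layers n ->
    gapped l F ->
    Rle (Rmult (Rplus (Rminus (INR k) 1) eps) (INR 'C(n, n./2))) (INR #|F|) ->
    exists H : {set {set {set 'I_n}}},
      (forall S, S \in H -> @induced_copy d P n F S) /\
      Rle (Rmult (pow delta #|P|)
                 (Rmult (pow (INR n) (l * (#|P| - 1))) (INR 'C(n, n./2))))
          (INR #|H|) /\
      (forall j : nat, 1 <= j <= #|P| ->
         Rle (INR (hDelta F H j)) (pow (Rmult delta (pow (INR n) l)) (#|P| - j))).
Proof.
move=> d P k treeP <- eps eps0 l l0.
have [P0 _ _] := treeP; have [x0 _] := card_gt0P P0.
have k0 : 0 < @height d P by apply: leq_ltn_trans (prank_height x0).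
have [e [he /ltP e0]] := archimed_cor1 eps eps0.
(* [q] is the constant of [prune] for the halved excess $1/(2e)$. The summands of [t] serve [tK] and
   [te], and the last one makes it positive. *)
pose q := 2 * @height d P * (2 * e * (@height d P).-1 + 1).
pose t := 3 * q * (6 ^ l * l`!) * (2 ^ #|P| * (2 * #|P|)) + 4 * e * #|P| + 1.
(* With $D=\lfloor2n/Q\rfloor$, the term $36qp$ gives $18qpD\le n$, and 24 keeps all sizes within
   $n/24$ of $n/2$ and [D] at most $n/12$. *)
pose Q := 36 * q * #|P| + 24.
have Q0 : 0 < Q by rewrite /Q; lia.
have [N1 hN1] := sqrt_nlogn_small Q0.
have t0 : 0 < t by rewrite /t addn1.
exists (Rinv (INR t)); split; first by apply: Rinv_0_lt_compat; apply/(INR_ltn 0).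
(* The summands serve, in turn, the estimate of $\sqrt{n\ln n}$, $6l\le n$, $2t\le n\le n^l$ and
   $n>0$. *)
exists (N1 + 6 * l + 2 * t + 1) => n nN F Fmid gapF sizeF.
have n0 : 0 < n by lia.
have close A : A \in F -> 2 * Q * #|A| < Q * n + 2 * n /\ Q * n < 2 * Q * #|A| + 2 * n.
  by move=> AF; apply: middle_layers_close => //; [apply: hN1; lia | apply: (subsetP Fmid)].
have Q24 : 24 * n <= Q * n by rewrite leq_mul2r leq_addl orbT.
have lo A : A \in F -> n <= 3 * #|A|.
  move=> /close[_ h].
  have h1 : Q * n <= 3 * (Q * n - 2 * n) by lia.
  have : Q * n < Q * (3 * #|A|) by lia.
  by rewrite ltn_pmul2l // => /ltnW.
have hi A : A \in F -> n <= 3 * (n - #|A|).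
  move=> /close[h _]; have : Q * (3 * #|A|) < Q * (2 * n) by lia.
  rewrite ltn_pmul2l //; lia.
have QD A B : A \in F -> B \in F -> #|A| <= #|B| + (2 * n) %/ Q.
  move=> /close[h1 _] /close[_ h2].
  have : Q * (#|A| - #|B|) <= 2 * n by rewrite mulnBr; lia.
  by rewrite mulnC -leq_divRL // leq_subLR.
have DQ : (2 * n) %/ Q * Q <= 2 * n by apply: leq_trunc_div.
have D24 : 24 * ((2 * n) %/ Q) <= 2 * n.
  by apply: leq_trans DQ; rewrite mulnC leq_mul2l leq_addl orbT.
have Dn : 3 * ((2 * n) %/ Q + l) <= n by lia.
have qn : 18 * q * #|P| * ((2 * n) %/ Q) <= n.
  have : 36 * q * #|P| * ((2 * n) %/ Q) <= 2 * n.
    by apply: leq_trans DQ; rewrite mulnC leq_mul2l leq_addr orbT.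
  by move: (q * #|P|) => c; lia.
have tm : 2 * t <= n ^ l.
  have : n <= n ^ l by rewrite -{1}(expn1 n) leq_pexp2l.
  lia.
have te : 4 * e * #|P| <= t by rewrite /t; lia.
have tK : 3 * q * (6 ^ l * l`!) * (2 ^ #|P| * (2 * #|P|)) <= t by rewrite /t -addnA leq_addr.
have sizeF' := density_nat k0 e0 he sizeF.
have ln : 6 * l <= n by lia.
have [H [[cH dH] hH]] := balanced_supersaturation treeP sizeF' gapF lo hi QD n0 ln Dn qn t0 te tK tm.
exists H; split=> //; split=> [|j jP].
  by apply: edge_bound_real => //; rewrite expnM subn1.
apply: degree_bound_real => //.
rewrite -leq_divRL ?expn_gt0 ?t0 //; apply/bigmax_leqP => X /andP[_ /eqP Xj].
by rewrite leq_divRL ?expn_gt0 ?t0 // -Xj; apply: dH; rewrite Xj.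
Qed.
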